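(* Let $p\in[1,\infty]$, $\theta_1,\theta_2\in[0,1)$ and $\Lambda,\Lambda'\subset\mathbb{N}$. Assume that the system $$\{\cos^\lambda 2\pi(t-\theta_1):\lambda\in\Lambda\}\cup\{\cos^{\lambda'}2\pi(t-\theta_2):\lambda'\in\Lambda'\}$$ is total in $X_p(0,1)$. Then $\theta_1-\theta_2\notin\mathbb{Q}$.
   Context: $\mathbb{N}=\{0,1,2,\ldots\}$. Functions on $[0,1]$ are identified with $1$-periodic functions on $\mathbb{R}$. $X_p(0,1)=L^p(0,1)$ if $1\le p<+\infty$, and $X_\infty(0,1)$ is the space of continuous $1$-periodic functions with the sup norm. A family is total in a normed space if its linear span is dense. *)

(* Defs.v *)
From HB Require Import structures.
From mathcomp Require Import all_boot all_order all_algebra.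
From mathcomp Require Import all_classical all_reals all_analysis.

Set Implicit Arguments.
Unset Strict Implicit.
Unset Printing Implicit Defensive.

Import Order.TTheory GRing.Theory Num.Theory.
Import numFieldNormedType.Exports.

Local Open Scope classical_set_scope.
Local Open Scope ring_scope.

Definition lin_span (R : realType) (V : lmodType R) (S : set V) : set V :=
  [set v | exists (n : nat) (c : 'I_n -> R) (x : 'I_n -> V),
     (forall i, S (x i)) /\ v = \sum_(i < n) c i *: x i].

(* A normed space is given by its set X of vectors inside an ambient lmodType V
   and by its norm N, extended-real valued because it is a function on all of V.
   As usual for L^p, N may be only a seminorm on X, the normed space being the
   quotient of X by the null vectors. *)
Definition total_in (R : realType) (V : lmodType R) (X : set V)
    (N : V -> \bar R) (S : set V) : Prop :=
  S `<=` X /\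
  forall f, X f -> forall e : R, 0 < e ->
    exists2 g, lin_span S g & (N (f - g)%R < e%:E)%E.

(* As a measure on R, Lebesgue measure on (0, 1) sees only the values taken on
   (0, 1): up to null functions, Lfun (leb01 R) p is L^p(0, 1). *)
Definition leb01 (R : realType) : {measure set (measurableTypeR R) -> \bar R} :=
  mrestr (@lebesgue_measure R) (measurable_itv `]0%R, 1%R[).

Definition Xp (R : realType) (p : \bar R) : set (R -> R) :=
  if p is +oo%E then [set f : R -> R | continuous f /\ periodic f 1]
  else [set f | f \in Lfun (leb01 R) p].

Definition Xp_norm (R : realType) (p : \bar R) (f : R -> R) : \bar R :=
  if p is +oo%E then ereal_sup (range (fun t : R => `|f t|%:E))
  else 'N[leb01 R]_p[EFin \o f]%E.

Definition cos_power (R : realType) (theta : R) (n : nat) : R -> R :=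
  fun t => cos (2 * pi * (t - theta)) ^+ n.

(* Main.v *)
Require Import Defs.
From mathcomp Require Import all_boot all_order all_algebra.
From mathcomp Require Import all_classical all_reals all_analysis.
From mathcomp Require Import measurable_realfun ring.

Import Order.TTheory GRing.Theory Num.Theory.
Import numFieldNormedType.Exports.

Local Open Scope classical_set_scope.
Local Open Scope ring_scope.

(** If [theta1 - theta2 = a / k] with [a], [k] integers and [k != 0], then
    [w t = sin (2 pi k (t - theta1))] is odd about [theta1], and it is odd about
    [theta2] as well because it equals [sin (2 pi k (t - theta2))]: the two
    phases differ by [2 pi a] ([sine_wave_shift]).  The powers
    [cos^n (2 pi (t - theta))] are even about [theta], so the nonzero bounded
    function [w] annihilates the whole system
    ([sine_wave_orthogonal_cos_power]), and the system cannot be total.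

    Quantitatively, for every [g] in the span, [w (w - g)] has mean
    [mean (w^2) = 1/2] over a period, while [|w| <= 1]; hence the mean of
    [|w - g|] is at least [1/2], and so is every [X_p] norm of [w - g]
    ([Xp_norm_ge]).  Thus [w], an element of [X_p], is not in the closure of
    the span.

    All means are computed from explicit primitives.  The mean value theorem
    turns them into a bound on the sup norm, and the fundamental theorem of
    calculus, followed by Hoelder's inequality on a probability space, into a
    bound on the [L^p] norms with [p] finite. *)

(** * Means over the unit interval *)

Section Mean.
Context {R : realType}.
Implicit Types (f g : R -> R) (m n c : R).

(** The mean of [f] over [[0, 1]] is [m], witnessed by a primitive.  In this form
    linearity needs no integrability hypotheses, and a single fact feeds both
    the mean value theorem and the fundamental theorem of calculus. *)
Definition has_mean f m : Prop :=
  exists2 F : R -> R,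
    (forall t : R, is_derive t (1 : R) F (f t)) & F 1 - F 0 = m.

Lemma has_mean_cst c : has_mean (cst c) c.
Proof.
exists (c \*: id) => [t|].
  by apply: is_derive_eq; rewrite /= scaler1.
by rewrite /= /GRing.scale/=; ring.
Qed.

Lemma has_meanD f g m n :
  has_mean f m -> has_mean g n -> has_mean (f \+ g) (m + n).
Proof.
move=> [F dF <-] [G dG <-]; exists (F + G) => [t|].
  exact: is_deriveD.
by rewrite !fctE; ring.
Qed.

Lemma has_meanZ c f m : has_mean f m -> has_mean (c \*: f) (c * m).
Proof.
move=> [F dF <-]; exists (c \*: F) => [t|].
  exact: is_deriveZ.
by rewrite /= /GRing.scale/=; ring.
Qed.

Lemma has_mean_sum k (f : 'I_k -> R -> R) :
  (forall i, has_mean (f i) 0) -> has_mean (fun t => \sum_(i < k) f i t) 0.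
Proof.
elim: k f => [|k IH] f f0.
  have -> : (fun t => \sum_(i < 0) f i t) = cst 0.
    by apply/funext => t; rewrite big_ord0.
  exact: has_mean_cst.
have -> : (fun t => \sum_(i < k.+1) f i t) =
    (fun t => \sum_(i < k) f (widen_ord (leqnSn k) i) t) \+ f ord_max.
  by apply/funext => t; rewrite big_ord_recr.
by rewrite -[X in has_mean _ X]addr0; apply: has_meanD => //; apply: IH.
Qed.

Lemma has_mean_MVT f m : has_mean f m -> exists c, f c = m.
Proof.
move=> [F dF <-].
have cF : {within `[0, 1], continuous F}.
  apply: derivable_within_continuous => t _.
  exact: ex_derive.
have [c _ ->] := MVT ltr01 (fun t _ => dF t) cF.
by exists c; rewrite subr0 mulr1.
Qed.

Lemma has_mean_integral f m : continuous f -> has_mean f m ->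
  (\int[lebesgue_measure]_(t in `[0%R, 1%R]) (f t)%:E = m%:E)%E.
Proof.
move=> cf [F dF <-]; rewrite EFinB; apply: continuous_FTC2 => //.
- exact: continuous_subspaceT.
- have cF t : {for t, continuous F}.
    apply: differentiable_continuous; rewrite -derivable1_diffP.
    exact: ex_derive.
  split.
  + by move=> t _; apply: ex_derive.
  + exact/cvg_at_right_filter/cF.
  + exact/cvg_at_left_filter/cF.
- by move=> t _; rewrite derive1E derive_val.
Qed.

End Mean.

(** * Sine waves and their orthogonality to powers of the cosine *)

Section Waves.
Context {R : realType}.
Implicit Types (theta : R) (k : int) (x t : R).

Lemma sinD2pi_int x k : sin (x + 2 * pi * k%:~R) = sin x.
Proof.
have sN n (y : R) : sin (y + 2 * pi * n%:R) = sin y.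
  rewrite -[RHS](periodicn (@sinD2pi R) n y); congr sin.
  by rewrite -mulrnA -[in RHS]mulr_natr natrM; ring.
case: k => n; first exact: sN.
by rewrite NegzE -[LHS](sN n.+1); congr sin; rewrite mulrNz -pmulrn; ring.
Qed.

Lemma cosD2pi_int x k : cos (x + 2 * pi * k%:~R) = cos x.
Proof.
by rewrite -!sinDpihalf -[RHS](sinD2pi_int _ k); congr sin; ring.
Qed.

Definition sine_wave theta k t : R := sin (k%:~R * (2 * pi * (t - theta))).
Definition cosine_wave theta k t : R := cos (k%:~R * (2 * pi * (t - theta))).

Lemma is_derive_phase theta k t :
  is_derive t (1 : R) (fun s => k%:~R * (2 * pi * (s - theta))) (k%:~R * (2 * pi)).
Proof.
have -> : (fun s => k%:~R * (2 * pi * (s - theta))) =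
    (k%:~R * (2 * pi)) \*: (id - cst theta : R -> R).
  by apply/funext => s; rewrite /= !fctE /GRing.scale/=; ring.
by apply: is_derive_eq; rewrite subr0 scaler1.
Qed.

Lemma sine_wave_derive theta k t :
  is_derive t (1 : R) (sine_wave theta k)
    (cosine_wave theta k t * (k%:~R * (2 * pi))).
Proof. exact: is_derive1_comp (is_derive_sin _) (is_derive_phase _ _ _). Qed.

Lemma cosine_wave_derive theta k t :
  is_derive t (1 : R) (cosine_wave theta k)
    (- sine_wave theta k t * (k%:~R * (2 * pi))).
Proof. exact: is_derive1_comp (is_derive_cos _) (is_derive_phase _ _ _). Qed.

Lemma sine_wave_continuous theta k : continuous (sine_wave theta k).
Proof.
move=> t; apply: differentiable_continuous; rewrite -derivable1_diffP.
apply: ex_derive; exact: sine_wave_derive.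
Qed.

Lemma cosine_wave_continuous theta k : continuous (cosine_wave theta k).
Proof.
move=> t; apply: differentiable_continuous; rewrite -derivable1_diffP.
apply: ex_derive; exact: cosine_wave_derive.
Qed.

Lemma sine_wave_periodic theta k : periodic (sine_wave theta k) 1.
Proof.
move=> t; rewrite /sine_wave -[RHS](sinD2pi_int _ k); congr sin; ring.
Qed.

Lemma cosine_wave_periodic theta k : periodic (cosine_wave theta k) 1.
Proof.
move=> t; rewrite /cosine_wave -[RHS](cosD2pi_int _ k); congr cos; ring.
Qed.

Lemma cos_powerE theta n : cos_power theta n = fun t => cosine_wave theta 1 t ^+ n.
Proof. by apply/funext => t; rewrite /cosine_wave mul1r. Qed.

Lemma cos_power_continuous theta n : continuous (cos_power theta n).
Proof.
rewrite cos_powerE => t; apply: (@cvg_comp _ _ _ _ (fun x => x ^+ n)).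
  exact: cosine_wave_continuous.
exact: exprn_continuous.
Qed.

Lemma phase_rate_neq0 k : k != 0 -> k%:~R * (2 * pi) != 0 :> R.
Proof. by move=> k0; rewrite !mulf_neq0 ?intr_eq0// gt_eqF// pi_gt0. Qed.

(** For [k != 0] the primitive is a multiple of the cosine wave, which takes the
    same value at both ends of a period; for [k = 0] the wave vanishes. *)
Lemma has_mean_sine_wave theta k : has_mean (sine_wave theta k) 0.
Proof.
have [->|k0] := eqVneq k 0.
  have -> : sine_wave theta 0 = cst 0.
    by apply/funext => t; rewrite /sine_wave mul0r sin0.
  exact: has_mean_cst.
exists ((- (k%:~R * (2 * pi))^-1) \*: cosine_wave theta k) => [t|].
  have /(is_deriveZ (- (k%:~R * (2 * pi))^-1)) := cosine_wave_derive theta k t.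
  move=> /is_derive_eq; apply.
  rewrite /GRing.scale/= [X in _ * X]mulNr mulrNN mulrC mulfK//.
  exact: phase_rate_neq0.
by rewrite -[1]add0r /= cosine_wave_periodic subrr.
Qed.

Lemma has_mean_cosine_wave theta k : k != 0 -> has_mean (cosine_wave theta k) 0.
Proof.
move=> k0.
exists ((k%:~R * (2 * pi))^-1 \*: sine_wave theta k) => [t|].
  have /(is_deriveZ ((k%:~R * (2 * pi))^-1)) := sine_wave_derive theta k t.
  move=> /is_derive_eq; apply; rewrite /GRing.scale/= mulrC mulfK//.
  exact: phase_rate_neq0.
by rewrite -[1]add0r /= sine_wave_periodic subrr.
Qed.

(** Induction on [n] with [k] free, by the product formula
    [2 sin(k u) cos u = sin((k + 1) u) + sin((k - 1) u)], which trades one factor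
    [cos u] for a shift of the frequency.  Frequencies range over all integers
    because [k - 1] may become zero or negative. *)
Lemma sine_wave_orthogonal_cos_power theta k n :
  has_mean (sine_wave theta k \* cos_power theta n) 0.
Proof.
elim: n k => [|n IH] k.
  have -> : sine_wave theta k \* cos_power theta 0 = sine_wave theta k.
    by apply/funext => t; rewrite /= /cos_power expr0 mulr1.
  exact: has_mean_sine_wave.
have -> : sine_wave theta k \* cos_power theta n.+1 =
    2^-1 \*: ((sine_wave theta (k + 1) \* cos_power theta n) \+
              (sine_wave theta (k - 1) \* cos_power theta n)).
  apply/funext => t; rewrite /= /sine_wave /cos_power exprS.
  set u := 2 * pi * (t - theta).
  rewrite rmorphD rmorphB/= mulrDl mulrBl !mul1r sinD sinB.
  by rewrite /GRing.scale/=; field.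
rewrite -[X in has_mean _ X](mulr0 2^-1) -[X in _ * X](addr0 0).
by apply: has_meanZ; apply: has_meanD.
Qed.

Lemma has_mean_sine_wave_sqr theta k : k != 0 ->
  has_mean (sine_wave theta k \* sine_wave theta k) 2^-1.
Proof.
move=> k0.
have -> : sine_wave theta k \* sine_wave theta k =
    cst 2^-1 \+ (- 2^-1) \*: cosine_wave theta (k *+ 2).
  apply/funext => t; rewrite /= /sine_wave /cosine_wave.
  set u := 2 * pi * (t - theta).
  rewrite rmorphMn/= mulrnAl cos_mulr2n cos2sin2 /GRing.scale/=.
  by field.
rewrite -[X in has_mean _ X]addr0 -[X in _ + X](mulr0 (- 2^-1)).
apply: has_meanD; first exact: has_mean_cst.
by apply: has_meanZ; apply: has_mean_cosine_wave; rewrite mulrn_eq0.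
Qed.

(** This is where rationality enters: moving the centre by a rational with
    denominator [k] shifts the phase by a multiple of [2 pi]. *)
Lemma sine_wave_shift theta1 theta2 k (a : int) :
  k%:~R * (theta1 - theta2) = a%:~R :> R ->
  sine_wave theta1 k = sine_wave theta2 k.
Proof.
move=> ka; apply/funext => t; rewrite /sine_wave.
rewrite -[RHS](sinD2pi_int _ (- a)); congr sin.
by rewrite rmorphN/= -ka; ring.
Qed.

End Waves.

(** * Lower bounds on the norms *)

Section Norms.
Context {R : realType}.

Lemma leb01_setT : leb01 R [set: R] = 1%E.
Proof.
rewrite /leb01/= /mrestr setTI.
by have := @lebesgue_measure_itv R `]0, 1[ => /= ->; rewrite lte_fin ltr01 sube0.
Qed.

(** The measure on the left ignores the complement of [(0, 1)]; the closed
    interval on the right is the one on which the fundamental theorem of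
    calculus is stated. *)
Lemma ge0_integral_leb01 (f : R -> R) : measurable_fun [set: R] f ->
  (forall t, 0 <= f t) ->
  (\int[leb01 R]_t (f t)%:E =
   \int[@lebesgue_measure R]_(t in `[0%R, 1%R]) (f t)%:E)%E.
Proof.
move=> mf f0.
pose D : set (measurableTypeR R) := `]0, 1[%classic.
have mD : measurable D := measurable_itv _.
rewrite (@ge0_negligible_integral _ _ _ _ setT (~` D)) //.
- rewrite setTD setCK.
  rewrite (@eq_measure_integral _ _ _ _ (@lebesgue_measure R)).
    rewrite /D -(@integral_itv_bndoo R 0 1 _ true false) //.
    by apply/measurable_EFinP; exact: measurable_funS mf.
  by move=> A mA AD; rewrite /leb01/= /mrestr setIidl.
- exact: measurableC.
- exact/measurable_EFinP.
- by move=> t _; rewrite lee_fin.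
- by rewrite /leb01/= /mrestr setICl measure0.
Qed.

(** Hoelder's inequality against the constant function [1], whose norms are all
    [1] on a probability space. *)
Lemma Lnorm1_le d (T : measurableType d) (mu : {measure set T -> \bar R})
    (p : R) (f : T -> R) : mu setT = 1%E -> 1 <= p ->
  measurable_fun [set: T] f ->
  ('N[mu]_1[EFin \o f] <= 'N[mu]_p%:E[EFin \o f])%E.
Proof.
move=> mu1 + mf; rewrite le_eqVlt => /predU1P[<-//|p1].
have p0 : 0 < p by rewrite (lt_trans ltr01).
(* [(1 - p^-1)^-1] is the exponent conjugate to [p]. *)
have q0 : 0 < (1 - p^-1)^-1 by rewrite invr_gt0 subr_gt0 invf_lt1.
have := @hoelder _ _ _ mu f (cst 1) p _ mf (measurable_cst _) p0 q0.
rewrite invrK subrKC => /(_ erefl).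
have -> : f \* cst 1 = f by apply/funext => t; rewrite /= mulr1.
by rewrite Lnorm_cst1 mu1 poweR1r mule1.
Qed.

Lemma bounded_Lfun d (T : measurableType d) (mu : {measure set T -> \bar R})
    (p : R) (f : T -> R) : mu setT = 1%E -> 0 < p ->
  measurable_fun [set: T] f -> (forall t, `|f t| <= 1) ->
  f \in Lfun mu p%:E.
Proof.
move=> mu1 p0 mf f1; rewrite inE; apply/andP; split; rewrite inE//=.
rewrite /finite_norm unlock /Lnorm poweR_lty//.
apply: (@le_lt_trans _ _ (\int[mu]_x (cst 1%E x))%E); last first.
  by rewrite integral_cst// mu1 mule1 ltry.
apply: ge0_le_integral => //.
- by move=> x _; rewrite lee_fin powR_ge0.
- apply/measurable_EFinP.
  apply: (@measurableT_comp _ _ _ _ _ _ (@powR R ^~ p)) => //.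
  exact: measurableT_comp.
- move=> x _; rewrite lee_fin.
  have -> : 1 = 1 `^ p :> R by rewrite powR1.
  rewrite ge0_ler_powR ?nnegrE//.
  exact: ltW.
Qed.

(** The duality bound [|mean (w f)| <= mean |f| <= ||f||_p] for a test function
    [w] bounded by [1].  For [p] infinite, the mean value theorem gives a point
    where [w f] equals its mean. *)
Lemma Xp_norm_ge (p : \bar R) (w f : R -> R) (m : R) : (1 <= p)%E ->
  continuous w -> (forall t, `|w t| <= 1) -> continuous f ->
  has_mean (w \* f) m -> (m%:E <= Xp_norm p f)%E.
Proof.
move=> p1 cw w1 cf wfm.
have wf_le t : `|w t * f t| <= `|f t| by rewrite normrM ler_piMl.
case: p p1 => [p|_|//].
- rewrite lee_fin => p1; rewrite /Xp_norm.
  have mf := continuous_measurable_fun cf.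
  have cwf : continuous (w \* f).
    by move=> t; apply: continuousM; [exact: cw|exact: cf].
  have mwf := continuous_measurable_fun cwf.
  apply: le_trans (Lnorm1_le _ _ _ _ _ leb01_setT p1 mf).
  rewrite Lnorm1 /= ge0_integral_leb01//; last exact: measurableT_comp.
  rewrite -(has_mean_integral _ _ cwf wfm).
  apply: (le_trans (lee_abs _)).
  apply: (le_trans (le_abse_integral _ _ _)) => //.
    by apply/measurable_EFinP; exact: measurable_funS mwf.
  apply: ge0_le_integral => //.
  + apply/measurable_EFinP; apply: measurableT_comp => //.
    exact: measurable_funS mwf.
  + apply/measurable_EFinP; apply: measurableT_comp => //.
    exact: measurable_funS mf.
  + by move=> t _; rewrite lee_fin; exact: wf_le.
- have [c <-] := has_mean_MVT _ _ wfm.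
  apply: (@le_trans _ _ `|f c|%:E); last by apply: ereal_sup_ubound; exists c.
  by rewrite lee_fin (le_trans (ler_norm _))//; exact: wf_le.
Qed.

End Norms.

Theorem lemma4p3 (R : realType) (p : \bar R) (theta1 theta2 : R)
    (Lambda Lambda' : set nat) (hp : (1 <= p)%E)
    (h1 : 0 <= theta1 < 1) (h2 : 0 <= theta2 < 1)
    (htot : total_in (Xp p) (Xp_norm p)
       (cos_power theta1 @` Lambda `|` cos_power theta2 @` Lambda')) :
  ~ rational (theta1 - theta2).
Proof.
case=> r _ rE; case: htot => _ dense.
pose w := sine_wave theta1 (denq r).
have w2 : w = sine_wave theta2 (denq r).
  apply: (sine_wave_shift _ _ _ (numq r)); rewrite -rE /ratr mulrC divfK//.
  by rewrite intr_eq0 denq_neq0.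
have cw : continuous w by apply: sine_wave_continuous.
have w1 t : `|w t| <= 1 by apply: sin_max.
have Xw : Xp p w.
  case: p hp {dense} => [p hp|_|//].
  - rewrite /Xp/=; apply: bounded_Lfun => //; first exact: leb01_setT.
      by rewrite (lt_le_trans ltr01).
    exact: continuous_measurable_fun.
  - by split=> //; apply: sine_wave_periodic.
have [g [n [c [x [xS ->]]]]] := dense w Xw 2^-1 ltac:(by rewrite invr_gt0).
apply/negP; rewrite -leNgt.
have sumE t : (\sum_(i < n) c i *: x i) t = \sum_(i < n) c i * x i t.
  by rewrite fct_sumE.
have x_cont i : continuous (x i).
  by case: (xS i) => -[k _ <-]; apply: cos_power_continuous.
have x_orth i : has_mean (w \* x i) 0.
  case: (xS i) => -[k _ <-]; last rewrite w2;
  exact: sine_wave_orthogonal_cos_power.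
apply: (Xp_norm_ge _ w) => //.
- move=> t; apply: continuousB; first exact: cw.
  have -> : \sum_(i < n) c i *: x i = fun t => \sum_(i < n) c i * x i t.
    by apply/funext => s; rewrite sumE.
  apply: continuous_big => [|i _ s]; first exact: add_continuous.
  by apply: continuousM; [exact: cst_continuous|exact: x_cont].
(* [w (w - g) = w^2 - \sum_i c_i (w x_i)], where only [w^2] has nonzero mean. *)
- have -> : w \* (w - \sum_(i < n) c i *: x i) =
      (w \* w) \+ (-1) \*: (fun t => \sum_(i < n) (c i \*: (w \* x i)) t).
    apply/funext => t; rewrite /= !fctE sumE mulrBr /GRing.scale/= mulN1r.
    by rewrite mulr_sumr; congr (_ - _); apply: eq_bigr => i _; ring.
  rewrite -[X in has_mean _ X]addr0 -[X in _ + X](mulr0 (-1)).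
  apply: has_meanD; first by apply: has_mean_sine_wave_sqr; exact: denq_neq0.
  apply: has_meanZ; apply: has_mean_sum => i.
  by rewrite -(mulr0 (c i)); apply: has_meanZ.
Qed.
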